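(* Let $\mathcal{E}=\mathcal{L}\oplus\mathcal{C}\oplus\mathcal{D}$ be the extended affine Lie algebra over $k$, $\mathcal{H}=k\begin{bmatrix}1&0\\0&-1\end{bmatrix}\oplus\mathcal{C}\oplus\mathcal{D}$ its standard MAD, and $S\in\mathcal{L}=\mathfrak{sl}_2(Q)$ the element described in the context. Let $\mathcal{H}'$ be any MAD of $\mathcal{E}$ which contains $S$. Then there is no $k$-Lie algebra automorphism $\phi$ of $\mathcal{E}$ such that $\phi(\mathcal{H}')=\mathcal{H}$.
   Context: Let $k$ be an algebraically closed field of characteristic $0$ and $R=k[t_1^{\pm1},t_2^{\pm1}]$. Let $Q=(t_1,t_2)$ be the quaternion $R$-algebra generated by $\imath,\jmath$ subject to $\imath^2=t_1$, $\jmath^2=t_2$, $\imath\jmath=-\jmath\imath$. It is $\mathbb{Z}^2$-graded over $k$ with one-dimensional components $Q^{(a,b)}=k\,\imath^a\jmath^b$. Let $\mathcal{L}=\mathfrak{sl}_2(Q)=[\mathfrak{gl}_2(Q),\mathfrak{gl}_2(Q)]$, where $\mathfrak{gl}_2(Q)=M_2(Q)$ with the commutator bracket; $\mathcal{L}=\bigoplus_{\lambda\in\mathbb{Z}^2}\mathcal{L}^\lambda$ is $\mathbb{Z}^2$-graded, $\mathcal{L}^{\lambda}$ being the matrices in $\mathcal{L}$ with all entries in $Q^{\lambda}$. Form on $\mathcal{L}$: $(x,y)=(x_{11}y_{11}+x_{12}y_{21}+x_{21}y_{12}+x_{22}y_{22})_0$ for $x=(x_{ij}),y=(y_{ij})$,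 where $q_0$ denotes the $Q^{(0,0)}=k$-component of $q\in Q$. Fix $\theta\in\mathrm{Hom}_{\mathbb{Z}}(\mathbb{Z}^2,k)$ with $\theta((1,0))=1$ and $\theta((0,1))$ not rational. Let $\partial_\theta$ be the derivation of $\mathcal{L}$ with $\partial_\theta(l)=\theta(\lambda)l$ for $l\in\mathcal{L}^\lambda$. Put $\mathcal{D}=k\partial_\theta$, $\mathcal{C}=\mathcal{D}^*$ (the $k$-dual space), and $\sigma:\mathcal{L}\times\mathcal{L}\to\mathcal{C}$, $\sigma(l_1,l_2)(\partial)=(\partial(l_1),l_2)$. Let $\mathcal{E}=\mathcal{L}\oplus\mathcal{C}\oplus\mathcal{D}$ with bracket $$[l_1\oplus c_1\oplus\partial_1,\;l_2\oplus c_2\oplus\partial_2]_{\mathcal{E}}=\big([l_1,l_2]_{\mathcal{L}}+\partial_1(l_2)-\partial_2(l_1)\big)\oplus\sigma(l_1,l_2)\oplus 0.$$ A MAD of $\mathcal{E}$ is a subalgebra that is maximal among the abelian $k$-ad-diagonalizable subalgebras of $\mathcal{E}$; a subalgebra $\mathfrak{m}$ is $k$-ad-diagonalizable if $\mathcal{E}$ has a $k$-basis of simultaneous eigenvectors for all $\mathrm{ad}(h)$, $h\in\mathfrak{m}$. The subalgebra $\mathcal{H}$ is a MAD of $\mathcal{E}$, called the standard MAD. Element $S$: let $V=Q\oplus Q$ be the free right $Q$-module of rank $2$ and identify $M_2(Q)=\mathrm{End}_Q(V)$ via the standard basis. Let $m:V\to Q$ be the (right) $Q$-linear map $m(u,v)=(1+\imath)u-(1+\jmath)v$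 and $W=\ker m$. It is known that $m$ is split, and $W$ is a projective $Q$-module of rank $1$ which is not free; fix a decomposition $V=W\oplus U$ with $U$ a free $Q$-module of rank $1$. Let $s\in\mathrm{End}_Q(V)$ be given by $s(w)=-w$ for $w\in W$ and $s(u)=u$ for $u\in U$, and let $S\in M_2(Q)$ be the matrix of $s$ in the standard basis. One has $S\in\mathfrak{sl}_2(Q)$, and a MAD of $\mathcal{E}$ containing $S$ exists. *)

(* Defs.v *)
From HB Require Import structures.
From mathcomp Require Import all_boot all_order all_algebra.
From mathcomp Require Import finmap monalg.
From mathcomp Require Import boolp classical_sets.
From mathcomp Require Import ring zify.

Set Implicit Arguments.
Unset Strict Implicit.
Unset Printing Implicit Defensive.

Import GRing.Theory.

Local Open Scope fset_scope.
Local Open Scope ring_scope.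

Definition Z2 : Type := (int * int)%type.
HB.instance Definition _ := GRing.Zmodule.on Z2.

(* The Laurent polynomial ring k[t1^{+-1}, t2^{+-1}] as the group algebra k[Z^2]:
   finitely supported functions Z^2 -> k with the convolution product;
   << c *g (a, b) >> is c t1^a t2^b. (The ring structure monalg puts on malg
   needs a monoid without nontrivial units, hence not Z^2.) *)
Definition laurent (k : comNzRingType) : Type := {malg k[Z2]}.

HB.instance Definition _ k := GRing.Lmodule.on (laurent k).

(* Locked only to keep unification from unfolding it. *)
HB.lock Definition laurent_mul (k : comNzRingType) (f g : laurent k) : laurent k :=
  \sum_(l <- msupp f) \sum_(m <- msupp g) << f@_l * g@_m *g l + m >>.

Section Laurent.
Variable k : comNzRingType.
Local Notation laurent_mul := (@laurent_mul k).
Implicit Types (f g h : laurent k) (l m : Z2) (c d : k).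

Definition laurent_one : laurent k := << 1 *g (0 : Z2) >>.


Lemma laurent_mulw (d1 d2 : {fset Z2}) f g :
  msupp f `<=` d1 -> msupp g `<=` d2 ->
  laurent_mul f g = \sum_(l <- d1) \sum_(m <- d2) << f@_l * g@_m *g l + m >>.
Proof.
move=> le_d1 le_d2; rewrite !laurent_mul.unlock (big_fset_incl _ le_d1) /=.
  apply/eq_bigr=> l _; apply/big_fset_incl => // m _ /mcoeff_outdom ->.
  by rewrite mulr0 monalgU0.
move=> l _ /mcoeff_outdom fl.
by rewrite big1 => // m _; rewrite fl mul0r monalgU0.
Qed.

Lemma laurent_mulC : commutative laurent_mul.
Proof.
move=> f g; rewrite !laurent_mul.unlock exchange_big; apply/eq_bigr=> l _.
by apply/eq_bigr=> m _; rewrite mulrC addrC.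
Qed.

Lemma laurent_mulUU c d l m :
  laurent_mul << c *g l >> << d *g m >> = << c * d *g l + m >>.
Proof. by rewrite (laurent_mulw msuppU_le msuppU_le) !big_seq_fset1 !mcoeffUU. Qed.

Lemma laurent_mulDl : left_distributive laurent_mul +%R.
Proof.
move=> f g h.
have sub0 : msupp (f + g) `<=` msupp f `|` msupp g by exact: msuppD_le.
rewrite (laurent_mulw sub0 (fsubset_refl _)).
rewrite (laurent_mulw (fsubsetUl (msupp f) (msupp g)) (fsubset_refl _)).
rewrite (laurent_mulw (fsubsetUr (msupp f) (msupp g)) (fsubset_refl _)).
rewrite -big_split /=; apply/eq_bigr=> l _.
rewrite -big_split /=; apply/eq_bigr=> m _.
by rewrite (mcoeffD l f g) mulrDl monalgUD.
Qed.

Lemma laurent_mulDr : right_distributive laurent_mul +%R.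
Proof. by move=> f g h; rewrite laurent_mulC laurent_mulDl !(laurent_mulC f). Qed.

Lemma laurent_mul0 f : laurent_mul 0 f = 0.
Proof. by apply: (addrI (laurent_mul 0 f)); rewrite -laurent_mulDl !addr0. Qed.

Lemma laurent_mulr0 f : laurent_mul f 0 = 0.
Proof. by rewrite laurent_mulC laurent_mul0. Qed.

Lemma laurent_ind (P : laurent k -> Prop) :
  P 0 -> (forall f g, P f -> P g -> P (f + g)) ->
  (forall c l, P << c *g l >>) -> forall f, P f.
Proof.
by move=> P0 PD PU f; rewrite [f]monalgE; elim/big_ind: _ => //.
Qed.

Lemma laurent_mulA : associative laurent_mul.
Proof.
move=> f g h; elim/laurent_ind: f => [|f f' IH IH'|c l].
- by rewrite !laurent_mul0.
- by rewrite !laurent_mulDl IH IH'.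
elim/laurent_ind: g => [|g g' IH IH'|d m].
- by rewrite !(laurent_mul0, laurent_mulr0).
- rewrite (laurent_mulDl g) 2!laurent_mulDr (laurent_mulDl (laurent_mul _ g)).
  exact (f_equal2 +%R IH IH').
elim/laurent_ind: h => [|h h' IH IH'|e n].
- by rewrite !laurent_mulr0.
- rewrite (laurent_mulDr _ h) 2!laurent_mulDr; exact (f_equal2 +%R IH IH').
by rewrite !laurent_mulUU mulrA addrA.
Qed.

Lemma laurent_mul1 : left_id laurent_one laurent_mul.
Proof.
elim/laurent_ind => [|f g IH IH'|c l].
- by rewrite laurent_mulr0.
- by rewrite laurent_mulDr IH IH'.
by rewrite laurent_mulUU mul1r add0r.
Qed.

Lemma laurent_one_neq0 : laurent_one != 0.
Proof. by rewrite monalgU_eq0 oner_eq0. Qed.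

HB.instance Definition _ := GRing.Zmodule_isComNzRing.Build (laurent k)
  laurent_mulA laurent_mulC laurent_mul1 laurent_mulDl laurent_one_neq0.

Lemma laurentMUU c d l m :
  (<< c *g l >> : laurent k) * (<< d *g m >> : laurent k) = << c * d *g l + m >>.
Proof. exact: laurent_mulUU. Qed.

Lemma laurent_scaleU c d l : c *: (<< d *g l >> : laurent k) = << c * d *g l >>.
Proof. by apply/malgP => m; rewrite mcoeffZ !mcoeffU mulrnAr. Qed.

Lemma laurent_scaleAl c f g : c *: (f * g) = c *: f * g.
Proof.
elim/laurent_ind: f => [|f f' IH IH'|d l].
- by rewrite mul0r !scaler0 mul0r.
- rewrite mulrDl !scalerDr mulrDl; exact (f_equal2 +%R IH IH').
elim/laurent_ind: g => [|g g' IH IH'|e m].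
- by rewrite !mulr0 scaler0.
- rewrite !mulrDr !scalerDr; exact (f_equal2 +%R IH IH').
by rewrite laurent_scaleU !laurentMUU laurent_scaleU mulrA.
Qed.

HB.instance Definition _ :=
  GRing.Lmodule_isLalgebra.Build k (laurent k) laurent_scaleAl.
HB.instance Definition _ := GRing.Lalgebra_isComAlgebra.Build k (laurent k).

End Laurent.

Definition lt1 (k : comNzRingType) : laurent k := << 1 *g ((1, 0) : Z2) >>.
Definition lt2 (k : comNzRingType) : laurent k := << 1 *g ((0, 1) : Z2) >>.

(* The quaternion algebra (a, b) over R: Quat x0 x1 x2 x3 is
   x0 + x1 i + x2 j + x3 ij, with i^2 = a, j^2 = b, ij = - ji. *)
Record quat (R : comNzRingType) (a b : R) :=
  Quat { qre : R; qi : R; qj : R; qij : R }.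

Section Quaternion.
Variables (R : comNzRingType) (a b : R).
Local Notation quat := (quat a b).
Local Notation Quat := (@Quat R a b).
Implicit Types (x y z : quat) (c d : R).

Definition quat_tuple x := (qre x, qi x, qj x, qij x).
Definition tuple_quat (u : R * R * R * R) : quat :=
  let: (x0, x1, x2, x3) := u in Quat x0 x1 x2 x3.

Lemma quat_tupleK : cancel quat_tuple tuple_quat.
Proof. by case. Qed.

HB.instance Definition _ := Choice.copy quat (can_type quat_tupleK).

Definition quat_add x y :=
  Quat (qre x + qre y) (qi x + qi y) (qj x + qj y) (qij x + qij y).
Definition quat_opp x := Quat (- qre x) (- qi x) (- qj x) (- qij x).

Lemma quat_addA : associative quat_add.
Proof. by case=> ? ? ? ? [? ? ? ?] [? ? ? ?]; rewrite /quat_add /= !addrA. Qed.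

Lemma quat_addC : commutative quat_add.
Proof. by move=> [? ? ? ?] [? ? ? ?]; congr Quat; rewrite /= addrC. Qed.

Lemma quat_add0 : left_id (Quat 0 0 0 0) quat_add.
Proof. by case=> ? ? ? ?; rewrite /quat_add /= !add0r. Qed.

Lemma quat_addN : left_inverse (Quat 0 0 0 0) quat_opp quat_add.
Proof. by case=> ? ? ? ?; rewrite /quat_add /= !addNr. Qed.

HB.instance Definition _ := GRing.isZmodule.Build quat
  quat_addA quat_addC quat_add0 quat_addN.

Definition quat_mul x y : quat :=
  Quat
   (qre x * qre y + a * qi x * qi y + b * qj x * qj y - a * b * qij x * qij y)
   (qre x * qi y + qi x * qre y - b * qj x * qij y + b * qij x * qj y)
   (qre x * qj y + qj x * qre y + a * qi x * qij y - a * qij x * qi y)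
   (qre x * qij y + qij x * qre y + qi x * qj y - qj x * qi y).
Definition quat_one := Quat 1 0 0 0.

Lemma quat_mulA : associative quat_mul.
Proof.
by move=> [? ? ? ?] [? ? ? ?] [? ? ? ?]; congr Quat; rewrite /=; ring.
Qed.

Lemma quat_mul1 : left_id quat_one quat_mul.
Proof. by move=> [? ? ? ?]; congr Quat; rewrite /=; ring. Qed.

Lemma quat_mulr1 : right_id quat_one quat_mul.
Proof. by move=> [? ? ? ?]; congr Quat; rewrite /=; ring. Qed.

Lemma quat_mulDl : left_distributive quat_mul +%R.
Proof.
by move=> [? ? ? ?] [? ? ? ?] [? ? ? ?]; congr Quat; rewrite /=; ring.
Qed.

Lemma quat_mulDr : right_distributive quat_mul +%R.
Proof.
by move=> [? ? ? ?] [? ? ? ?] [? ? ? ?]; congr Quat; rewrite /=; ring.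
Qed.

Lemma quat_one_neq0 : quat_one != 0.
Proof. by apply/eqP => -[/eqP]; rewrite oner_eq0. Qed.

HB.instance Definition _ := GRing.Zmodule_isNzRing.Build quat
  quat_mulA quat_mul1 quat_mulr1 quat_mulDl quat_mulDr quat_one_neq0.

Definition quat_scale c x := Quat (c * qre x) (c * qi x) (c * qj x) (c * qij x).

Lemma quat_scaleA c d x : quat_scale c (quat_scale d x) = quat_scale (c * d) x.
Proof. by rewrite /quat_scale /= !mulrA. Qed.

Lemma quat_scale1 : left_id 1 quat_scale.
Proof. by case=> ? ? ? ?; rewrite /quat_scale /= !mul1r. Qed.

Lemma quat_scaleDr : right_distributive quat_scale +%R.
Proof. by move=> c [? ? ? ?] [? ? ? ?]; congr Quat; rewrite /= mulrDr. Qed.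

Lemma quat_scaleDl x : {morph quat_scale^~ x : c d / c + d}.
Proof. by move=> c d; congr Quat; rewrite /= mulrDl. Qed.

HB.instance Definition _ := GRing.Zmodule_isLmodule.Build R quat
  quat_scaleA quat_scale1 quat_scaleDr quat_scaleDl.

Lemma quat_scaleAl c x y : c *: (x * y) = c *: x * y.
Proof. by move: x y => [? ? ? ?] [? ? ? ?]; congr Quat; rewrite /=; ring. Qed.

HB.instance Definition _ := GRing.Lmodule_isLalgebra.Build R quat quat_scaleAl.

Lemma quat_scaleAr c x y : c *: (x * y) = x * (c *: y).
Proof. by move: x y => [? ? ? ?] [? ? ? ?]; congr Quat; rewrite /=; ring. Qed.

HB.instance Definition _ := GRing.Lalgebra_isAlgebra.Build R quat quat_scaleAr.

Definition imath := Quat 0 1 0 0.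
Definition jmath := Quat 0 0 1 0.

Lemma imath_sq : imath * imath = a%:A.
Proof. by congr Quat; rewrite /=; ring. Qed.

Lemma jmath_sq : jmath * jmath = b%:A.
Proof. by congr Quat; rewrite /=; ring. Qed.

Lemma imath_jmath : imath * jmath = - (jmath * imath).
Proof. by congr Quat; rewrite /=; ring. Qed.

Lemma quatE x :
  x = qre x *: 1 + qi x *: imath + qj x *: jmath + qij x *: (imath * jmath).
Proof. by case: x => ? ? ? ?; congr Quat; rewrite /=; ring. Qed.

End Quaternion.

Arguments imath {R a b}.
Arguments jmath {R a b}.

Definition Q (k : comNzRingType) : Type := quat (lt1 k) (lt2 k).
HB.instance Definition _ k := GRing.Algebra.on (Q k).

Definition oddz (a : int) : bool := (a %% 2)%Z == 1.
Definition halfz (a : int) : int := (a %/ 2)%Z.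

Section Torus.
Variable k : comNzRingType.
Local Notation L := (laurent k).
Local Notation Q := (Q k).
Implicit Types (q r : Q) (l m : Z2) (c : k) (th : {additive Z2 -> k}).

Definition kQ c : Q := (c%:A : L)%:A.

(* i^e1 j^e2-component, e1, e2 in {0, 1} *)
Definition Qpart q (e1 e2 : bool) : L :=
  match e1, e2 with
  | false, false => qre q | true, false => qi q
  | false, true => qj q | true, true => qij q
  end.
Definition Qof (f : bool -> bool -> L) : Q :=
  Quat _ _ (f false false) (f true false) (f false true) (f true true).

Definition halfZ2 l : Z2 := (halfz l.1, halfz l.2).

(* The monomial i^a j^b, l = (a, b), is t1^(a div 2) t2^(b div 2) times
   i^(a mod 2) j^(b mod 2). *)
Definition Qmon l : Q :=
  Qof (fun e1 e2 => if (e1 == oddz l.1) && (e2 == oddz l.2)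
                    then << 1 *g halfZ2 l >> else 0).

(* The coefficient of i^a j^b. *)
Definition Qcoef l q : k := (Qpart q (oddz l.1) (oddz l.2))@_(halfZ2 l).

Definition Qhomog l q : Prop := exists c, q = kQ c * Qmon l.

Definition dblZ2 (m : Z2) (e1 e2 : bool) : Z2 := (2 * m.1 + e1%:Z, 2 * m.2 + e2%:Z).

(* multiplies the coefficient of each t^m by w m *)
Definition laurent_wt (w : Z2 -> k) (f : L) : L :=
  \sum_(m <- msupp f) << w m * f@_m *g m >>.

(* multiplies the coefficient of each i^a j^b by th (a, b) *)
Definition Qder th q : Q :=
  Qof (fun e1 e2 => laurent_wt (fun m => th (dblZ2 m e1 e2)) (Qpart q e1 e2)).

Lemma QofP q r : (forall e1 e2, Qpart q e1 e2 = Qpart r e1 e2) -> q = r.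
Proof.
move: q r => [? ? ? ?] [? ? ? ?] H.
by congr Quat; [exact: (H false false)|exact: (H true false)
  |exact: (H false true)|exact: (H true true)].
Qed.

Lemma QpartOf f e1 e2 : Qpart (Qof f) e1 e2 = f e1 e2.
Proof. by case: e1 e2 => [] []. Qed.

Lemma QpartD q r e1 e2 : Qpart (q + r) e1 e2 = Qpart q e1 e2 + Qpart r e1 e2.
Proof. by case: e1 e2 => [] []. Qed.

Lemma laurent_wtE w (f : L) m : (laurent_wt w f)@_m = w m * f@_m.
Proof.
rewrite raddf_sum /= [in RHS](monalgE f) raddf_sum mulr_sumr.
by apply/eq_bigr => i _; rewrite /= !mcoeffU; case: eqP => [->|_]; rewrite ?mulr1n ?mulr0n ?mulr0.
Qed.

Lemma laurent_wtD w (f g : L) :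
  laurent_wt w (f + g) = laurent_wt w f + laurent_wt w g.
Proof.
apply/malgP => m; rewrite laurent_wtE.
by rewrite (mcoeffD m (f : {malg k[Z2]}) g) mulrDr
  (mcoeffD m (laurent_wt w f : {malg k[Z2]})) !laurent_wtE.
Qed.

Lemma laurent_wtU w c m : laurent_wt w << c *g m >> = << w m * c *g m >>.
Proof.
apply/malgP => n; rewrite laurent_wtE !mcoeffU.
by case: eqP => [->|_]; rewrite ?mulr1n ?mulr0n ?mulr0.
Qed.

Lemma oddz_dbl a (e : bool) : oddz (2 * a + e%:Z) = e.
Proof. rewrite /oddz; case: e; lia. Qed.

Lemma halfz_dbl a (e : bool) : halfz (2 * a + e%:Z) = a.
Proof. rewrite /halfz; case: e; lia. Qed.

Lemma dbl_half l : dblZ2 (halfZ2 l) (oddz l.1) (oddz l.2) = l.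
Proof.
case: l => a b; rewrite /dblZ2 /halfZ2 /halfz /oddz /=.
by congr pair; lia.
Qed.

Lemma QcoefP q r : (forall l, Qcoef l q = Qcoef l r) -> q = r.
Proof.
move=> H; apply: QofP => e1 e2; apply/malgP => m.
have := H (dblZ2 m e1 e2).
by rewrite /Qcoef /= !oddz_dbl /halfZ2 /= !halfz_dbl -surjective_pairing.
Qed.

Lemma Qcoef_mon l m : Qcoef l (Qmon m) = (l == m)%:R.
Proof.
rewrite /Qcoef QpartOf; case: ifP => [/andP [/eqP e1 /eqP e2]|h].
  rewrite mcoeffU; congr (_ *+ _); congr nat_of_bool; apply/eqP/eqP => [h|->//].
  by rewrite -(dbl_half l) -(dbl_half m) h e1 e2.
have -> : (l == m) = false by apply/negP => /eqP lm; rewrite lm !eqxx in h.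
exact: mcoeff0.
Qed.

Lemma Qcoef_der th l q : Qcoef l (Qder th q) = th l * Qcoef l q.
Proof. by rewrite /Qcoef QpartOf laurent_wtE dbl_half. Qed.

Lemma Qmon0 : Qmon 0 = 1.
Proof. by []. Qed.

Lemma kQE c x0 x1 x2 x3 :
  kQ c * Quat _ _ x0 x1 x2 x3 = Quat _ _ (c *: x0) (c *: x1) (c *: x2) (c *: x3).
Proof.
rewrite /kQ mulr_algl; congr Quat; exact: mulr_algl.
Qed.

Lemma QpartZ c q e1 e2 : Qpart (kQ c * q) e1 e2 = c *: Qpart q e1 e2.
Proof. by case: q => *; rewrite kQE; case: e1 e2 => [] []. Qed.

Lemma QcoefZ c l q : Qcoef l (kQ c * q) = c * Qcoef l q.
Proof. by rewrite /Qcoef QpartZ mcoeffZ. Qed.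

Lemma QcoefD l : {morph Qcoef l : q r / q + r}.
Proof. by move=> q r; rewrite /Qcoef QpartD; exact: mcoeffD. Qed.

Lemma lt1U m : lt1 k * (<< 1 *g m >> : L) = << 1 *g ((m.1 + 1, m.2) : Z2) >>.
Proof.
rewrite laurentMUU mulr1; congr mkmalgU.
by case: m => u v; congr pair; rewrite /= ?add0r // addrC.
Qed.

Lemma lt2U m : lt2 k * (<< 1 *g m >> : L) = << 1 *g ((m.1, m.2 + 1) : Z2) >>.
Proof.
rewrite laurentMUU mulr1; congr mkmalgU.
by case: m => u v; congr pair; rewrite /= ?add0r // addrC.
Qed.

Lemma imath_Qmon l : imath * Qmon l = Qmon (l.1 + 1, l.2).
Proof.
have E x0 x1 x2 x3 : imath * Quat (lt1 k) (lt2 k) x0 x1 x2 x3 =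
    Quat _ _ (lt1 k * x1) x0 (lt1 k * x3) x2.
  by congr Quat; rewrite /=; ring.
case: l => a b; rewrite /Qmon /Qof E /=.
have [o h1 h2] : [/\ oddz (a + 1) = ~~ oddz a,
    ~~ oddz a -> halfz (a + 1) = halfz a & oddz a -> halfz (a + 1) = halfz a + 1].
  by rewrite /oddz /halfz; split; lia.
rewrite o /halfZ2 /=; move: h1 h2; case: (oddz a) => h1 h2 /=.
  rewrite (h2 isT); congr Quat; case: (oddz b); rewrite //= ?mulr0 //.
  + exact: lt1U.
  + exact: lt1U.
by rewrite (h1 isT); congr Quat; case: (oddz b); rewrite //= ?mulr0.
Qed.

Lemma Qmon_jmath l : Qmon l * jmath = Qmon (l.1, l.2 + 1).
Proof.
have E x0 x1 x2 x3 : Quat (lt1 k) (lt2 k) x0 x1 x2 x3 * jmath =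
    Quat _ _ (lt2 k * x2) (lt2 k * x3) x0 x1.
  by congr Quat; rewrite /=; ring.
case: l => a b; rewrite /Qmon /Qof E /=.
have [o h1 h2] : [/\ oddz (b + 1) = ~~ oddz b,
    ~~ oddz b -> halfz (b + 1) = halfz b & oddz b -> halfz (b + 1) = halfz b + 1].
  by rewrite /oddz /halfz; split; lia.
rewrite o /halfZ2 /=; move: h1 h2; case: (oddz b) => h1 h2 /=.
  rewrite (h2 isT); congr Quat; case: (oddz a); rewrite //= ?mulr0 //.
  + exact: lt2U.
  + exact: lt2U.
by rewrite (h1 isT); congr Quat; case: (oddz a); rewrite //= ?mulr0.
Qed.

Lemma laurent_wtM (th : {additive Z2 -> k}) (f g : L) (w := fun m : Z2 => th (m *+ 2)) :
  laurent_wt w (f * g) = laurent_wt w f * g + f * laurent_wt w g.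
Proof.
have w0 : laurent_wt w 0 = 0 by apply: (addrI (laurent_wt w 0)); rewrite -laurent_wtD !addr0.
elim/laurent_ind: f => [|f f' IH IH'|c l].
- by rewrite w0 !mul0r w0 addr0.
- rewrite !(mulrDl, laurent_wtD) addrACA; exact (f_equal2 +%R IH IH').
elim/laurent_ind: g => [|g g' IH IH'|d m].
- by rewrite w0 !mulr0 w0 addr0.
- rewrite !(mulrDr, laurent_wtD) addrACA; exact (f_equal2 +%R IH IH').
rewrite laurentMUU !laurent_wtU !laurentMUU -monalgUD; congr mkmalgU.
by rewrite /w mulrnDl raddfD; ring.
Qed.

Lemma QderD th : {morph Qder th : q r / q + r}.
Proof.
by move=> q r; apply: QcoefP => l; rewrite QcoefD !Qcoef_der QcoefD mulrDr.
Qed.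

Lemma QderZ th c q : Qder th (kQ c * q) = kQ c * Qder th q.
Proof.
by apply: QcoefP => l; rewrite QcoefZ !Qcoef_der QcoefZ mulrCA.
Qed.

Lemma QderM th q r : Qder th (q * r) = Qder th q * r + q * Qder th r.
Proof.
pose w m := th (m *+ 2); pose d := laurent_wt w.
pose u : L := (th ((1, 0) : Z2))%:A; pose v : L := (th ((0, 1) : Z2))%:A.
have wE e1 e2 (f : L) : laurent_wt (fun m => th (dblZ2 m e1 e2)) f =
    d f + (u *+ e1 + v *+ e2) * f.
  apply/malgP => m; rewrite laurent_wtE.
  have -> : (d f + (u *+ e1 + v *+ e2) * f : L) =
      d f + (th ((1, 0) : Z2) *+ e1 + th ((0, 1) : Z2) *+ e2) *: f.
    by rewrite scalerDl mulrDl !mulrnAl !mulr_algl !scalerMnl.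
  rewrite (mcoeffD m (d f : {malg k[Z2]})) laurent_wtE mcoeffZ -mulrDl /w.
  congr (_ * _); rewrite -!raddfMn -!raddfD; congr (th _).
  case: m => a b; rewrite /dblZ2 /=; case: e1; case: e2; congr pair => /=; lia.
have dD : {morph d : f g / f + g} by exact: laurent_wtD.
have dM f g : d (f * g) = d f * g + f * d g by exact: laurent_wtM.
have dN f : d (- f) = - d f.
  by apply/malgP => m; rewrite laurent_wtE !mcoeffN laurent_wtE mulrN.
have d1 : d (lt1 k) = u *+ 2 * lt1 k.
  rewrite /d laurent_wtU mulrnAl mulr_algl scalerMnl laurent_scaleU /w.
  by rewrite raddfMn.
have d2 : d (lt2 k) = v *+ 2 * lt2 k.
  rewrite /d laurent_wtU mulrnAl mulr_algl scalerMnl laurent_scaleU /w.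
  by rewrite raddfMn.
move: q r => [x0 x1 x2 x3] [y0 y1 y2 y3].
rewrite /Qder /Qof /=; congr Quat; rewrite /= !wE /= !mulr0n !mulr1n;
  rewrite ?(dD, dN, dM, d1, d2); ring.
Qed.

End Torus.

Section Sl2.
Variable k : comNzRingType.
Local Notation Q := (Q k).
Local Notation gl2 := 'M[Q]_2.
Implicit Types (A B : gl2) (c : k) (th : {additive Z2 -> k}).

Definition glbr A B : gl2 := A *m B - B *m A.

(* The derived algebra [gl2, gl2]: a k-multiple of a commutator is again a
   commutator, so sums of commutators are enough. *)
Definition sl2_pred : {pred gl2} := fun A =>
  `[< exists s : seq (gl2 * gl2), A = \sum_(x <- s) glbr x.1 x.2 >].

Lemma sl2_predP A :
  reflect (exists s : seq (gl2 * gl2), A = \sum_(x <- s) glbr x.1 x.2)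
          (A \in sl2_pred).
Proof. exact: asboolP. Qed.

Lemma glbrNl A B : glbr (- A) B = - glbr A B.
Proof. by rewrite /glbr mulNmx mulmxN opprD opprK. Qed.

Lemma glbr_sl2 A B : glbr A B \in sl2_pred.
Proof. by apply/sl2_predP; exists [:: (A, B)]; rewrite big_seq1. Qed.

Lemma sl2_zmod_closed : zmod_closed sl2_pred.
Proof.
split=> [|A B /sl2_predP [s ->] /sl2_predP [r ->]].
  by apply/sl2_predP; exists [::]; rewrite big_nil.
apply/sl2_predP; exists (s ++ [seq (- x.1, x.2) | x <- r]).
rewrite big_cat big_map /= -sumrN; congr (_ + _).
by apply: eq_bigr => x _; rewrite glbrNl.
Qed.

HB.instance Definition _ := GRing.isZmodClosed.Build gl2 sl2_pred sl2_zmod_closed.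

Record sl2 := SL2 { sl2_val :> gl2; sl2P : sl2_val \in sl2_pred }.

HB.instance Definition _ := [isSub for sl2_val].
HB.instance Definition _ := [Choice of sl2 by <:].
HB.instance Definition _ := [SubChoice_isSubZmodule of sl2 by <:].

Lemma kQ_in_alg c : kQ c = in_alg Q (in_alg (laurent k) c).
Proof. by []. Qed.

Lemma kQM c d : kQ (c * d) = kQ c * kQ d :> Q.
Proof. by rewrite !kQ_in_alg !rmorphM. Qed.

Lemma kQ1 : kQ 1 = 1 :> Q.
Proof. by rewrite !kQ_in_alg !rmorph1. Qed.

Lemma kQD c d : kQ (c + d) = kQ c + kQ d :> Q.
Proof. by rewrite !kQ_in_alg !rmorphD. Qed.

Lemma kQC c (q : Q) : kQ c * q = q * kQ c.
Proof. by rewrite /kQ mulr_algl mulr_algr. Qed.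

Lemma scale_mulmxr c A B : A *m (kQ c *: B) = kQ c *: (A *m B).
Proof.
apply/matrixP => i j; rewrite !mxE mulr_sumr; apply: eq_bigr => l _.
by rewrite !mxE mulrA -kQC mulrA.
Qed.

Lemma scale_glbr c A B : kQ c *: glbr A B = glbr (kQ c *: A) B.
Proof. by rewrite /glbr scalerBr (scale_mulmxr c B A) (scalemxAl _ A B). Qed.

Lemma sl2_scaleP c (x : sl2) : kQ c *: sl2_val x \in sl2_pred.
Proof.
case: x => A /= /sl2_predP [s ->]; rewrite scaler_sumr.
by apply: rpred_sum => x _; rewrite scale_glbr glbr_sl2.
Qed.

Definition sl2_scale c (x : sl2) : sl2 := SL2 (sl2_scaleP c x).

Lemma sl2_scaleA c d x : sl2_scale c (sl2_scale d x) = sl2_scale (c * d) x.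
Proof. by apply: val_inj; rewrite /= scalerA kQM. Qed.

Lemma sl2_scale1 : left_id 1 sl2_scale.
Proof. by move=> x; apply: val_inj; rewrite /= kQ1 scale1r. Qed.

Lemma sl2_scaleDr : right_distributive sl2_scale +%R.
Proof. by move=> c x y; apply: val_inj; rewrite /= scalerDr. Qed.

Lemma sl2_scaleDl x : {morph sl2_scale^~ x : c d / c + d}.
Proof. by move=> c d; apply: val_inj; rewrite /= kQD scalerDl. Qed.

HB.instance Definition _ := GRing.Zmodule_isLmodule.Build k sl2
  sl2_scaleA sl2_scale1 sl2_scaleDr sl2_scaleDl.

Definition sl2_br (x y : sl2) : sl2 := SL2 (glbr_sl2 (sl2_val x) (sl2_val y)).

Definition sl2_homog (l : Z2) (x : sl2) : Prop :=
  forall i j, Qhomog l (sl2_val x i j).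

Definition sl2_form (x y : sl2) : k := Qcoef 0 (\tr (sl2_val x *m sl2_val y)).

Lemma mx_derM th A B : map_mx (Qder th) (A *m B) =
  map_mx (Qder th) A *m B + A *m map_mx (Qder th) B.
Proof.
apply/matrixP => i j; rewrite !mxE !big_ord_recl !big_ord0 /= !addr0 !mxE.
by rewrite QderD !QderM addrACA.
Qed.

Lemma mx_der_sl2 th (x : sl2) : map_mx (Qder th) (sl2_val x) \in sl2_pred.
Proof.
have D0 : Qder th 0 = 0 :> Q.
  by apply: (addrI (Qder th 0)); rewrite -QderD !addr0.
have DN q : Qder th (- q) = - Qder th q.
  by apply: (addrI (Qder th q)); rewrite -QderD !subrr.
have mD A B : map_mx (Qder th) (A + B) = map_mx (Qder th) A + map_mx (Qder th) B.
  by apply/matrixP => i j; rewrite !mxE QderD.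
have mN A : map_mx (Qder th) (- A) = - map_mx (Qder th) A.
  by apply/matrixP => i j; rewrite !mxE DN.
have m0 : map_mx (Qder th) (0 : gl2) = 0 by apply/matrixP => i j; rewrite !mxE D0.
case: x => A /= /sl2_predP [s ->]; rewrite (big_morph _ mD m0).
apply: rpred_sum => -[B C] _; rewrite /glbr mD mN !mx_derM /=.
rewrite (_ : _ - _ = glbr (map_mx (Qder th) B) C + glbr B (map_mx (Qder th) C)).
  by rewrite rpredD // glbr_sl2.
have gen (V : zmodType) (a b c d : V) : a + b - (c + d) = a - d + (b - c).
  by rewrite opprD [- c - d]addrC addrACA.
exact: gen.
Qed.

(* partial_theta; by dtheta_homog below it is theta(lambda) on L^lambda. *)
Definition dtheta th (x : sl2) : sl2 := SL2 (mx_der_sl2 th x).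

Lemma dtheta_homog th l x : sl2_homog l x -> dtheta th x = th l *: x.
Proof.
move=> hx; apply: val_inj; apply/matrixP => i j; rewrite !mxE.
have [c ->] := hx i j; apply: QcoefP => m.
rewrite Qcoef_der !QcoefZ Qcoef_mon; case: eqP => [->|_] //.
by rewrite !mulr0.
Qed.

End Sl2.

Section LieAlgebra.
Local Open Scope classical_set_scope.
Variables (k : fieldType) (V : lmodType k) (br : V -> V -> V).
Implicit Types (B m : set V).

Definition is_subspace m : Prop :=
  m 0 /\ forall (a : k) x y, m x -> m y -> m (a *: x + y).

Definition is_subalgebra m : Prop :=
  is_subspace m /\ forall x y, m x -> m y -> m (br x y).

Definition is_abelian m : Prop := forall x y, m x -> m y -> br x y = 0.

Definition lin_indep B : Prop :=
  forall (s : seq V) (a : V -> k), uniq s -> {in s, forall x, B x} ->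
    \sum_(x <- s) a x *: x = 0 -> {in s, forall x, a x = 0}.

Definition spanning B : Prop :=
  forall v, exists (s : seq V) (a : V -> k),
    {in s, forall x, B x} /\ v = \sum_(x <- s) a x *: x.

Definition is_basis B : Prop := lin_indep B /\ spanning B.

Definition ad_diagonalizable m : Prop :=
  exists2 B, is_basis B &
    forall b h, B b -> m h -> exists a : k, br h b = a *: b.

Definition ab_ad_diag_subalgebra m : Prop :=
  [/\ is_subalgebra m, is_abelian m & ad_diagonalizable m].

Definition is_MAD m : Prop :=
  ab_ad_diag_subalgebra m /\
  forall m', ab_ad_diag_subalgebra m' -> m `<=` m' -> m' = m.

Definition is_lie_aut (f : {linear V -> V}) : Prop :=
  bijective f /\ forall x y, f (br x y) = br (f x) (f y).

End LieAlgebra.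

Section EALA.
Variables (k : fieldType) (th : {additive Z2 -> k}).
Local Notation L := (sl2 k).

(* D = k partial_theta is identified with k: the scalar d stands for the
   derivation d partial_theta. C is its linear dual. *)
Definition Dsp (k : fieldType) : vectType k := k^o.
Definition Csp (k : fieldType) : vectType k := 'Hom(Dsp k, k^o).

Definition Dact (d : Dsp k) (x : L) : L := (d : k) *: dtheta th x.

Definition sigma (x y : L) : Csp k :=
  linfun (fun d : Dsp k => sl2_form (Dact d x) y : k^o).

Lemma sl2_formZl (a : k) (x y : L) : sl2_form (a *: x) y = a * sl2_form x y.
Proof.
rewrite /sl2_form -QcoefZ; congr Qcoef.
by rewrite -mxtraceZ; congr mxtrace; rewrite scalemxAl.
Qed.

Lemma sigmaE (x y : L) (d : Dsp k) : sigma x y d = sl2_form (Dact d x) y.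
Proof.
have lin : linear (fun d : Dsp k => sl2_form (Dact d x) y : k^o).
  move=> a u v; rewrite /Dact !sl2_formZl.
  by rewrite [(a *: u + v : k) * _]mulrDl -mulrA.
pose f : {linear Dsp k -> k^o} := HB.pack (fun d : Dsp k => sl2_form (Dact d x) y : k^o)
  (GRing.isLinear.Build k (Dsp k) k^o *:%R _ lin).
exact: (lfunE f d).
Qed.

Definition EALA (k : fieldType) : lmodType k := (sl2 k * Csp k * Dsp k)%type.

Definition Ebr (x y : EALA k) : EALA k :=
  let: (l1, c1, d1) := x in let: (l2, c2, d2) := y in
  (sl2_br l1 l2 + Dact d1 l2 - Dact d2 l1, sigma l1 l2, 0).

Definition Eof (x : L) : EALA k := (x, 0, 0).

Lemma hmx_sl2 : \matrix_(i < 2, j < 2) (if i == j then (-1) ^+ i else 0)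
                \in @sl2_pred k.
Proof.
apply/sl2_predP; exists [:: (delta_mx 0 1, delta_mx 1 0)]; rewrite big_seq1.
rewrite /glbr /= !mul_delta_mx; apply/matrixP => i j; rewrite !mxE.
by case: i => [[|[|i]] ?] //; case: j => [[|[|j]] ?] //=;
   rewrite /= ?subr0 ?sub0r ?expr0 ?expr1.
Qed.

(* diag (1, -1) *)
Definition sl2_h : L := SL2 hmx_sl2.

Definition stdMAD : set (EALA k) :=
  [set x | exists a : k, x.1.1 = a *: sl2_h]%classic.

End EALA.

Section RightModules.
Local Open Scope classical_set_scope.
Variables (A : nzRingType) (n : nat).
Implicit Types (W U : set 'cV[A]_n).

(* A^n is the right A-module of columns, with M_n(A) = End(A^n) acting by M *m v.
   U is a submodule which is free of rank r, with basis the columns of B *)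
Definition right_free (r : nat) U : Prop :=
  exists2 B : 'M[A]_(n, r), (forall q : 'cV[A]_r, B *m q = 0 -> q = 0) &
    U = range (fun q : 'cV[A]_r => B *m q).

Definition internal_direct_sum W U : Prop :=
  (forall v, exists2 w, W w & exists2 u, U u & v = w + u) /\
  (forall v, W v -> U v -> v = 0).

End RightModules.

Definition mQ (k : comNzRingType) (v : 'cV[Q k]_2) : Q k :=
  (1 + imath) * v 0 0 - (1 + jmath) * v 1 0.

Definition kerW (k : comNzRingType) : set 'cV[Q k]_2 := [set v | mQ v = 0]%classic.

Arguments kerW : clear implicits.
Arguments stdMAD : clear implicits.

(* Main.v *)
Require Import Defs.
From HB Require Import structures.
From mathcomp Require Import all_boot all_order all_algebra.
From mathcomp Require Import finmap monalg.
From mathcomp Require Import boolp classical_sets.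
From mathcomp Require Import ring zify.

Set Implicit Arguments.
Unset Strict Implicit.
Unset Printing Implicit Defensive.

Import GRing.Theory.

Local Open Scope classical_set_scope.
Local Open Scope ring_scope.

(** Let [h] be the matrix diag(1, -1), [i] and [j] the generators of the
    quaternion algebra, and suppose that an automorphism [phi] maps H' onto the
    standard MAD, so that [phi S = a h + c + d dtheta].

    The matrix of [S] is an involution, hence [ad S] satisfies
    [x^3 = 4 x] modulo the centre C ([ad_cube_involution]), and so does
    [ad (phi S)].  Now [ad (phi S)] scales [i^n E_12] by [2a + dn] modulo C, and
    [x^3 - 4x] cannot vanish on a whole arithmetic progression of step [d != 0];
    this leaves [d = 0] and [a] in {0, 1, -1} ([ad_cube_central_h]).  If [a = 0]
    then [S] is central, which is absurd.  If [a = 1] or [a = -1] then, modulo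
    C, [phi S] is the neutral element of the sl2-triple formed with the two
    off-diagonal matrix units; pulling that triple back along [phi] gives [X]
    and [Y] in sl2(Q) with [[S, X] = 2 X], [[S, Y] = - 2 Y] and [[X, Y] = S]
    ([standard_pullback_triple]).

    The obstruction to such a triple is the module W.  The eigenvalues force
    [X] to map W to U, and [Y] to map U to W and to kill W, so [[X, Y] = S]
    says that [Y X] is the identity on W.  Hence W = Y(U), and as U is free of
    rank 1, W is generated by a single column [b = (p, q)]
    ([splitting_no_triple]).

    That W has no single generator ([kerW_not_cyclic]) is a computation with
    supports in Z^2.  The product of monomials [i^a j^b] is a monomial up to
    sign, so leading coefficients for a translation-invariant total order
    multiply to a nonzero coefficient.  Since W contains columns with first
    entry [1 - j^2] and second entry [1 - i^2], [p] is a left factor of the former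
    and [q] of the latter.  Lexicographic leading and trailing terms then show
    that [p] is homogeneous in [i] and [q] is homogeneous in [j]
    ([Qcoef_factor]).  But [(1 + i) p = (1 + j) q] then lives on a unit square
    of exponents, around which the signs coming from [i j = - j i] do not
    match ([common_multiple0]). *)

(** * Coefficients of products in the quaternion torus *)

Section Coefficients.
Variable k : comNzRingType.
Implicit Types (f : laurent k) (q r : Q k) (l m n : Z2).

Lemma mcoeff_shift m n f : ((<< 1 *g m >> : laurent k) * f)@_(m + n) = f@_n.
Proof.
elim/laurent_ind: f => [|f g IH IH'|c u].
- by rewrite mulr0 !mcoeff0.
- rewrite mulrDr (mcoeffD _ ((<< 1 *g m >> : laurent k) * f : {malg k[Z2]})).
  by rewrite IH IH' (mcoeffD _ (f : {malg k[Z2]})).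
by rewrite laurentMUU mul1r !mcoeffU (inj_eq (addrI m)).
Qed.

Lemma oddzD (a b : int) : oddz (a + b) = oddz a (+) oddz b.
Proof. rewrite /oddz; lia. Qed.

Lemma halfzD (a b : int) :
  halfz (a + b) = halfz a + halfz b + (oddz a && oddz b)%:Z.
Proof. rewrite /oddz /halfz; lia. Qed.

(** Moving [j^b] past [i^a] costs the sign [(-1)^(ab)], and halving exponents
    carries exactly when two odd ones meet; both are settled on parities. *)
Lemma Qcoef_monM m l q :
  Qcoef (m + l) (Qmon k m * q) = (-1) ^+ (oddz m.2 && oddz l.1) * Qcoef l q.
Proof.
case: m l q => [m1 m2] [l1 l2] [x0 x1 x2 x3].
rewrite /Qcoef /halfZ2 /= !oddzD !halfzD.
have E (w w' : Z2) f : w'.1 = w.1 + halfz l1 -> w'.2 = w.2 + halfz l2 ->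
    ((<< 1 *g w >> : laurent k) * f)@_w' = f@_((halfz l1, halfz l2) : Z2).
  move=> h1 h2; rewrite -(mcoeff_shift w _ f); congr (_ @_ _).
  by case: w w' h1 h2 => [? ?] [? ?] /= -> ->.
rewrite /Qmon /Qof /= /halfZ2 /= /lt1 /lt2.
by case: (oddz m1); case: (oddz m2); case: (oddz l1); case: (oddz l2);
  rewrite /= !(mul0r, mulr0, add0r, addr0, subr0, sub0r, oppr0, laurentMUU, mulr1);
  rewrite ?mcoeffN E ?expr0 ?expr1 ?mul1r ?mulN1r //=; lia.
Qed.

Lemma Qcoef0 l : Qcoef l (0 : Q k) = 0.
Proof. by apply: (addrI (Qcoef l (0 : Q k))); rewrite -QcoefD !addr0. Qed.

Lemma QcoefN l q : Qcoef l (- q) = - Qcoef l q.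
Proof. by apply: (addrI (Qcoef l q)); rewrite -QcoefD !subrr Qcoef0. Qed.

Lemma Qcoef_sum l (I : Type) (s : seq I) (F : I -> Q k) :
  Qcoef l (\sum_(i <- s) F i) = \sum_(i <- s) Qcoef l (F i).
Proof. exact: (big_morph _ (QcoefD l) (Qcoef0 l)). Qed.

Lemma Qcoef_neq0 q : q <> 0 -> exists l, Qcoef l q != 0.
Proof.
move=> q0; apply: contrapT => nex; apply: q0; apply: QcoefP => l.
rewrite Qcoef0; apply/eqP/negP => /negP ql; apply: nex; by exists l.
Qed.

Definition Qsupp q : seq Z2 :=
  undup (flatten [seq [seq dblZ2 m e.1 e.2 | m <- msupp (Qpart q e.1 e.2)]
    | e <- [:: (false, false); (false, true); (true, false); (true, true)]]).

Lemma Qsupp_out q l : l \notin Qsupp q -> Qcoef l q = 0.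
Proof.
apply: contraNeq => ql; rewrite mem_undup; apply/flattenP.
exists [seq dblZ2 m (oddz l.1) (oddz l.2)
         | m <- msupp (Qpart q (oddz l.1) (oddz l.2))].
  by apply/mapP; exists (oddz l.1, oddz l.2) => //; case: oddz; case: oddz.
by apply/mapP; exists (halfZ2 l); rewrite ?dbl_half // -mcoeff_neq0.
Qed.

Lemma Qmon_expand q :
  q = \sum_(m <- Qsupp q) kQ (Qcoef m q) * Qmon k m.
Proof.
apply: QcoefP => l; rewrite Qcoef_sum.
under eq_bigr => m _ do rewrite QcoefZ Qcoef_mon.
have [lq|lq] := boolP (l \in Qsupp q); last first.
  rewrite Qsupp_out // big1_seq // => m /= mq.
  by case: eqP => [lm|_]; [rewrite lm mq in lq|rewrite mulr0].
rewrite (bigD1_seq l) ?undup_uniq //= eqxx mulr1 big1 ?addr0 // => m.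
by rewrite eq_sym => /negbTE ->; rewrite mulr0.
Qed.

Lemma QcoefM n q r : Qcoef n (q * r) = \sum_(m <- Qsupp q)
  Qcoef m q * ((-1) ^+ (oddz m.2 && oddz (n - m).1) * Qcoef (n - m) r).
Proof.
rewrite {1}(Qmon_expand q) mulr_suml Qcoef_sum; apply: eq_bigr => m _.
by rewrite -mulrA QcoefZ -Qcoef_monM addrC subrK.
Qed.

End Coefficients.

(** * Leading terms *)

Section LeadingTerms.
Variables (k : fieldType) (le : rel Z2).
Hypotheses (le_total : total le) (le_trans : transitive le)
  (le_anti : antisymmetric le)
  (le_add : forall l m n, le l m -> le (l + n) (m + n)).
Implicit Types (q r : Q k) (l m n : Z2).

Definition is_leading q l := Qcoef l q != 0 /\ forall m, Qcoef m q != 0 -> le m l.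

Lemma leading_exists q : q <> 0 -> exists l, is_leading q l.
Proof.
move=> /Qcoef_neq0 [l ql].
have max (s : seq Z2) : exists2 n, Qcoef n q != 0 &
    forall m, m \in s -> Qcoef m q != 0 -> le m n.
  elim: s => [|u s [n qn IH]]; first by exists l.
  have [qu|qu] := eqVneq (Qcoef u q) 0.
    exists n => // m; rewrite inE => /orP [/eqP ->|]; last exact: IH.
    by rewrite qu eqxx.
  case/orP: (le_total u n) => un.
    exists n => // m; rewrite inE => /orP [/eqP ->//|]; exact: IH.
  exists u => // m; rewrite inE => /orP [/eqP -> _|ms qm].
    by case/orP: (le_total u u).
  exact: le_trans (IH _ ms qm) un.
have [n qn H] := max (Qsupp q); exists n; split=> // m qm.
by apply: H => //; apply: contraNT qm => /Qsupp_out ->.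
Qed.

(** The sum of the two maximal exponents is attained by no other pair of
    exponents of the supports. *)
Lemma leading_mul_neq0 q r l m :
  is_leading q l -> is_leading r m -> Qcoef (l + m) (q * r) != 0.
Proof.
move=> [ql Hq] [rm Hr]; rewrite QcoefM (bigD1_seq l) ?undup_uniq //=; last first.
  by apply: contraNT ql => /Qsupp_out ->.
rewrite big1 => [|n nl]; last first.
  apply/eqP; rewrite mulf_eq0; apply: contraNT nl; rewrite negb_or => /andP [qn].
  rewrite mulf_eq0 negb_or => /andP [_ rn]; apply/eqP/le_anti.
  rewrite Hq //=; have := le_add (n - m) (Hr _ rn).
  by rewrite addrA subrK addrK [m + _]addrC subrK.
rewrite addr0 [l + m]addrC addrK !mulf_neq0 ?signr_eq0 //.
Qed.
End LeadingTerms.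

(** The support of a left factor is controlled by that of the product: leading
    terms for the order that compares [f] first and [g] second multiply, and so
    do trailing terms, so the [f]-width of the product is the sum of the
    [f]-widths of the factors.  Width 0 of the product forces width 0. *)
Lemma Qcoef_factor (k : fieldType) (f g : Z2 -> int) (q r : Q k) (c : int) :
  {morph f : l m / l + m} -> {morph g : l m / l + m} ->
  (forall l m, f l = f m -> g l = g m -> l = m) ->
  q * r <> 0 -> (forall l, Qcoef l (q * r) != 0 -> f l = c) ->
  exists d, forall l, Qcoef l q != 0 -> f l = d.
Proof.
move=> fD gD fgI qr0 qrc.
have [q0 r0] : q <> 0 /\ r <> 0.
  by split=> e; apply: qr0; rewrite e ?mul0r ?mulr0.
pose le l m := (f l < f m) || (f l == f m) && (g l <= g m).
have leE l m : le l m = ((f l < f m) || (f l == f m) && (g l <= g m)) by [].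
have tot : total le by move=> l m; rewrite !leE; lia.
have tr : transitive le by move=> l m n; rewrite !leE; lia.
have anti : antisymmetric le.
  by move=> l m; rewrite !leE => h; apply: fgI; lia.
have add l m n : le l m -> le (l + n) (m + n) by rewrite !leE !fD !gD; lia.
pose ge l m := le m l.
have tot' : total ge by move=> l m; exact: tot.
have tr' : transitive ge by move=> l m n h h'; exact: tr h' h.
have anti' : antisymmetric ge by move=> l m; rewrite andbC => /anti.
have add' l m n : ge l m -> ge (l + n) (m + n) by exact: add.
have [lq Hq] := leading_exists tot tr q0; have [lr Hr] := leading_exists tot tr r0.
have [lq' Hq'] := leading_exists tot' tr' q0; have [lr' Hr'] := leading_exists tot' tr' r0.
have := qrc _ (leading_mul_neq0 anti add Hq Hr).
have := qrc _ (leading_mul_neq0 anti' add' Hq' Hr').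
rewrite !fD => e' e; exists (f lq) => l ql.
have := Hq.2 _ ql; have := Hq'.2 _ ql; rewrite /ge.
have := Hr.2 _ Hr'.1; rewrite !leE; lia.
Qed.

(** * The kernel module has no single generator *)

Lemma imathE (k : comNzRingType) : imath = Qmon k (1, 0).
Proof. by rewrite -[imath]mulr1 -Qmon0 imath_Qmon /= add0r. Qed.

Lemma jmathE (k : comNzRingType) : jmath = Qmon k (0, 1).
Proof. by rewrite -[jmath]mul1r -Qmon0 Qmon_jmath /= add0r. Qed.

Section NotCyclic.
Variable k : fieldType.
Implicit Types (q : Q k) (l : Z2).

Lemma Qcoef_1Di (a b : int) q :
  Qcoef (a, b) ((1 + imath) * q) = Qcoef (a, b) q + Qcoef (a - 1, b) q.
Proof.
rewrite mulrDl mul1r QcoefD imathE; congr (_ + _).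
have -> : (a, b) = ((1, 0) : Z2) + (a - 1, b) by congr pair; rewrite /=; lia.
by rewrite Qcoef_monM /= mul1r.
Qed.

Lemma Qcoef_1Dj (a b : int) q : Qcoef (a, b) ((1 + jmath) * q) =
  Qcoef (a, b) q + (-1) ^+ oddz a * Qcoef (a, b - 1) q.
Proof.
rewrite mulrDl mul1r QcoefD jmathE; congr (_ + _).
have -> : (a, b) = ((0, 1) : Z2) + (a, b - 1) by congr pair; rewrite /=; lia.
by rewrite Qcoef_monM.
Qed.

(** Both sides are supported on the square [{a, a + 1} x {b, b + 1}].  Its lower
    edge gives [p_b = q_a = q_(a+1)] and its upper edge
    [p_(b+1) = s q_a = - s q_(a+1)] with [s = (-1)^a], hence [2 q_a = 0]. *)
Lemma common_multiple0 (p q : Q k) (a b : int) : 2 != 0 :> k ->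
  (forall l, Qcoef l p != 0 -> l.1 = a) ->
  (forall l, Qcoef l q != 0 -> l.2 = b) ->
  (1 + imath) * p = (1 + jmath) * q -> p = 0.
Proof.
move=> nz2 pa qb pq.
have E m n : Qcoef (m, n) p + Qcoef (m - 1, n) p =
    Qcoef (m, n) q + (-1) ^+ oddz m * Qcoef (m, n - 1) q.
  by rewrite -Qcoef_1Di -Qcoef_1Dj pq.
have p0 m n : m <> a -> Qcoef (m, n) p = 0.
  by move=> ma; apply/eqP; apply/negP => /negP /pa.
have q0 m n : n <> b -> Qcoef (m, n) q = 0.
  by move=> nb; apply/eqP; apply/negP => /negP /qb.
have E1 n : Qcoef (a, n) p = Qcoef (a, n) q + (-1) ^+ oddz a * Qcoef (a, n - 1) q.
  by rewrite -E (p0 (a - 1)) ?addr0 //; lia.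
have E2 n : Qcoef (a, n) p =
    Qcoef (a + 1, n) q + (-1) ^+ oddz (a + 1) * Qcoef (a + 1, n - 1) q.
  by rewrite -E (p0 (a + 1)) ?add0r ?addrK //; lia.
have pb : Qcoef (a, b) p = 0.
  have := E2 (b + 1); rewrite E1 addrK !(q0 _ (b + 1)) ?add0r; try lia.
  have := E2 b; rewrite E1 !(q0 _ (b - 1)) ?mulr0 ?addr0; try lia.
  move=> <-; rewrite oddzD signr_addb expr1 mulrN1 mulNr => /eqP.
  by rewrite -subr_eq0 opprK -mulr2n -mulr_natl !mulf_eq0 signr_eq0 (negbTE nz2) => /eqP.
apply: QcoefP => -[m n]; rewrite Qcoef0.
have [->|/eqP/p0->//] := eqVneq m a.
have [->//|/eqP nb] := eqVneq n b.
have qab : Qcoef (a, b) q = 0.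
  by rewrite -pb E1 (q0 a (b - 1)) ?mulr0 ?addr0 //; lia.
rewrite E1 q0 // add0r; have [->|/eqP h] := eqVneq (n - 1) b.
  by rewrite qab mulr0.
by rewrite q0 ?mulr0.
Qed.

Definition col2 (p q : Q k) : 'cV[Q k]_2 := \col_i (if i == 0 then p else q).

Lemma kerW_not_cyclic (b : 'cV[Q k]_2) : 2 != 0 :> k -> mQ b = 0 ->
  ~ (forall w, kerW k w -> exists c : 'cV_1, w = b *m c).
Proof.
move=> nz2 /eqP; rewrite subr_eq0 => /eqP bW H.
have kerD (p q : Q k) : (1 + imath) * p = (1 + jmath) * q -> kerW k (col2 p q).
  by rewrite /kerW /= /mQ !mxE /= => ->; rewrite subrr.
have fac p q : (1 + imath) * p = (1 + jmath) * q ->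
    exists c, p = b 0 0 * c /\ q = b 1 0 * c.
  move=> /kerD /H [c e]; exists (c 0 0).
  by split; [move/matrixP: e => /(_ 0 0)|move/matrixP: e => /(_ 1 0)];
    rewrite !mxE big_ord1.
have i2 : Qcoef 0 (1 - imath * imath : Q k) = 1.
  by rewrite QcoefD QcoefN imathE imath_Qmon -Qmon0 !Qcoef_mon /= subr0.
have j2 : Qcoef 0 (1 - jmath * jmath : Q k) = 1.
  by rewrite QcoefD QcoefN {1}jmathE Qmon_jmath -Qmon0 !Qcoef_mon /= subr0.
have nz q : Qcoef 0 q = 1 -> q <> 0.
  by move=> + e; rewrite e Qcoef0 => /esym/eqP; rewrite oner_eq0.
(* Both pairs lie in the kernel because [1 - j] commutes with [1 + j] and
   [1 - i] with [1 + i]. *)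
have [|c [ec _]] := fac (1 - jmath * jmath) ((1 - jmath) * (1 + imath)).
  by congr Quat; rewrite /=; ring.
have [|d [_ ed]] := fac ((1 - imath) * (1 + jmath)) (1 - imath * imath).
  by congr Quat; rewrite /=; ring.
have supp (m n l : Z2) : Qcoef l (Qmon k m - Qmon k n) != 0 -> l = m \/ l = n.
  rewrite QcoefD QcoefN !Qcoef_mon; have [->|_] := eqVneq l m; first by left.
  by have [->|_] := eqVneq l n; [right|rewrite subrr eqxx].
have [||||l|a Ha] := @Qcoef_factor k fst snd (b 0 0) c 0 => //.
- by move=> [? ?] [? ?] /= -> ->.
- by rewrite -ec; apply: nz.
- by rewrite -ec {1}jmathE Qmon_jmath -Qmon0 => /supp [] ->.
have [||||l|a' Ha'] := @Qcoef_factor k snd fst (b 1 0) d 0 => //.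
- by move=> [? ?] [? ?] /= -> ->.
- by rewrite -ed; apply: nz.
- by rewrite -ed imathE imath_Qmon -Qmon0 => /supp [] ->.
have b0 := common_multiple0 nz2 Ha Ha' bW.
by apply: (nz _ j2); rewrite ec b0 mul0r.
Qed.
End NotCyclic.

(** * The centre of sl2(Q) *)

Lemma ord2P (i : 'I_2) : i = 0 \/ i = 1.
Proof. by case: i => [[|[|//]]] ?; [left|right]; apply: val_inj. Qed.

Section Centre.
Variable k : fieldType.
Implicit Types (q : Q k) (x y z : sl2 k).

Lemma mulmx_scale_delta (A : 'M[Q k]_2) q (i j r s : 'I_2) :
  (A *m (q *: delta_mx i j)) r s = if s == j then A r i * q else 0.
Proof.
rewrite mxE (bigD1 i) //= big1 => [|u /negbTE ui]; last first.
  by rewrite !mxE ui mulr0 mulr0.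
by rewrite !mxE eqxx /= addr0; case: (s == j); rewrite ?mulr1 ?mulr0.
Qed.

Lemma scale_delta_mulmx (A : 'M[Q k]_2) q (i j r s : 'I_2) :
  ((q *: delta_mx i j) *m A) r s = if r == i then q * A j s else 0.
Proof.
rewrite mxE (bigD1 j) //= big1 => [|u /negbTE uj]; last first.
  by rewrite !mxE uj andbF mulr0 mul0r.
by rewrite !mxE eqxx andbT addr0; case: (r == i); rewrite ?mulr1 ?mulr0 ?mul0r.
Qed.

(** The commutator is [q E_ij] when [i != j]; writing it this way makes the
    membership in the derived algebra immediate. *)
Definition sl2_unit (i j : 'I_2) q : sl2 k :=
  SL2 (glbr_sl2 (delta_mx i i) (q *: delta_mx i j)).

Lemma sl2_unitE i j q : i != j -> sl2_val (sl2_unit i j q) = q *: delta_mx i j.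
Proof.
move=> ij; rewrite /sl2_unit /= /glbr -scalemxAl mul_delta_mx_0 1?eq_sym //.
rewrite scaler0 subr0; apply/matrixP => r s.
rewrite mulmx_scale_delta !mxE eqxx andbT.
by case: (r == i); case: (s == j); rewrite /= ?mul1r ?mulr1 ?mulr0 ?mul0r.
Qed.

Lemma qre_sum (I : finType) (F : I -> Q k) :
  qre (\sum_i F i) = \sum_i qre (F i).
Proof. by elim/big_rec2: _ => // i y x _ /= <-. Qed.

Lemma qre_trC (A B : 'M[Q k]_2) : qre (\tr (A *m B)) = qre (\tr (B *m A)).
Proof.
have tr C D : qre (\tr (C *m D)) =
    \sum_i \sum_j qre ((C : 'M[Q k]_2) i j * (D : 'M[Q k]_2) j i).
  by rewrite qre_sum; apply: eq_bigr => i _; rewrite mxE -qre_sum.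
rewrite !tr exchange_big; apply: eq_bigr => i _; apply: eq_bigr => j _ /=.
by ring.
Qed.

Lemma sl2_qre_tr x : qre (\tr (sl2_val x)) = 0.
Proof.
have qreD : {morph (fun A : 'M[Q k]_2 => qre (\tr A)) : p q / p + q}.
  by move=> A B /=; rewrite mxtraceD.
case: x => A /= /sl2_predP [s ->].
have qre0 : qre (\tr (0 : 'M[Q k]_2)) = 0 by rewrite mxtrace0.
rewrite (big_morph _ qreD qre0).
apply: big1 => -[B C] _; rewrite /glbr raddfB /=.
by rewrite -[LHS]/(qre (\tr (B *m C)) - qre (\tr (C *m B))) qre_trC subrr.
Qed.

(** Commuting with the [q E_ij] makes [z] a scalar matrix with central entry
    [s], so [s] lies in R; commutators have traces with zero R-component, whence
    [2 s = 0]. *)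
Lemma sl2_centre z : 2 != 0 :> k -> (forall x, sl2_br z x = 0) -> z = 0.
Proof.
move=> nz2 zC.
have C i j q r s : i != j ->
    (if s == j then sl2_val z r i * q else 0) = (if r == i then q * sl2_val z j s else 0).
  move=> ij; rewrite -mulmx_scale_delta -scale_delta_mulmx -sl2_unitE //.
  have /(congr1 (@sl2_val k))/eqP := zC (sl2_unit i j q).
  by rewrite /= subr_eq0 => /eqP ->.
have l2 (f : laurent k) : f = - f -> f = 0.
  move/eqP; rewrite -subr_eq0 opprK -mulr2n -scaler_nat scaler_eq0.
  by rewrite (negbTE nz2) => /eqP.
have off i j : i != j -> sl2_val z j i = 0.
  move=> ij; have := C i j 1 j j ij.
  by rewrite eqxx mulr1 eq_sym (negbTE ij).
have diag i j q : i != j -> sl2_val z i i * q = q * sl2_val z j j.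
  by move=> ij; have := C i j q i j ij; rewrite !eqxx.
have z01 : sl2_val z 1 1 = sl2_val z 0 0.
  by have := diag 0 1 1 isT; rewrite mulr1 mul1r.
have di := diag 0 1 imath isT; have dj := diag 0 1 jmath isT.
have tr0 := sl2_qre_tr z.
move: tr0 di dj; rewrite /mxtrace big_ord_recl big_ord1.
rewrite (_ : lift _ _ = 1) ?z01; last by apply: val_inj.
move=> tr0 di dj.
have z0 : sl2_val z 0 0 = 0.
  case: (sl2_val z 0 0) tr0 di dj => x0 x1 x2 x3 /=.
  move=> tr0 di dj; congr Quat.
  - by apply: l2; apply/eqP; rewrite -addr_eq0; apply/eqP.
  - apply: l2; have := congr1 (@qij _ _ _) dj; rewrite /=.
    by rewrite !(mulr0, mul0r, add0r, addr0, subr0, sub0r, mulr1, mul1r).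
  - apply: l2; have := congr1 (@qij _ _ _) di; rewrite /=.
    by rewrite !(mulr0, mul0r, add0r, addr0, subr0, sub0r, mulr1, mul1r).
  have {di} : lt1 k * x3 = 0.
    apply: l2; have := congr1 (@qj _ _ _) di; rewrite /=.
    by rewrite !(mulr0, mul0r, add0r, addr0, subr0, sub0r, mulr1, mul1r).
  by move=> e; apply/malgP => n; rewrite -(mcoeff_shift (1, 0) n x3) e !mcoeff0.
apply: val_inj; apply/matrixP => i j; rewrite [RHS]mxE.
by case: (ord2P i) => ->; case: (ord2P j) => ->; rewrite ?z01 ?z0 //; apply: off.
Qed.
End Centre.

(** * Splittings and sl2-triples *)

Section Splitting.
Variable k : fieldType.
Hypothesis char0 : [pchar k] =i pred0.

Lemma char0_neq0 n : n.+1%:R != 0 :> k.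
Proof. by rewrite ((pcharf0P k).1 char0). Qed.

(** The scalar [n + 1] is invertible already in the field. *)
Lemma Qmod_mulrn_eq0 (V : lmodType (Q k)) (v : V) n : v *+ n.+1 = 0 -> v = 0.
Proof.
move=> vn; rewrite -[v]scale1r -kQ1 -(mulVf (char0_neq0 n)) kQM -scalerA.
have -> : kQ n.+1%:R = n.+1%:R :> Q k by rewrite kQ_in_alg !rmorph_nat.
by rewrite scaler_nat vn scaler0.
Qed.

Lemma mulmx_cV_inj (A B : 'M[Q k]_2) :
  (forall v : 'cV_2, A *m v = B *m v) -> A = B.
Proof.
move=> AB; apply/matrixP => i j; have := AB (delta_mx j 0).
by rewrite -!colE => /matrixP /(_ i 0); rewrite !mxE.
Qed.

Variables (U : set 'cV[Q k]_2) (S : 'M[Q k]_2).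
Hypotheses (V_eq : internal_direct_sum (kerW k) U)
  (S_W : forall w, kerW k w -> S *m w = - w) (S_U : forall u, U u -> S *m u = u).

Lemma splitting_involution : S *m S = 1%:M.
Proof.
apply: mulmx_cV_inj => v; have [w Ww [u Uu ->]] := V_eq.1 v.
rewrite -mulmxA mulmxDr (S_W Ww) (S_U Uu) mulmxDr mulmxN (S_W Ww) (S_U Uu).
by rewrite opprK mul1mx.
Qed.

Lemma splitting_fixed v : S *m v = v -> U v.
Proof.
have [w Ww [u Uu ->]] := V_eq.1 v; rewrite mulmxDr (S_W Ww) (S_U Uu).
move/addIr/eqP; rewrite eq_sym -subr_eq0 opprK -mulr2n => /eqP/Qmod_mulrn_eq0 ->.
by rewrite add0r.
Qed.

Lemma splitting_negated v : S *m v = - v -> kerW k v.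
Proof.
have [w Ww [u Uu ->]] := V_eq.1 v; rewrite mulmxDr (S_W Ww) (S_U Uu) opprD.
move/addrI/eqP; rewrite -subr_eq0 opprK -mulr2n => /eqP/Qmod_mulrn_eq0 ->.
by rewrite addr0.
Qed.

(** [S] acts on [X W] by [2 - 1 = 1] and on [Y U] by [1 - 2 = - 1], so [X W] lies
    in U and [Y U] in W; it would act on [Y W] by [- 3], so [Y W = 0].  Then
    [S = X Y - Y X] gives [w = Y X w] on W, and the generator of U is sent by [Y]
    to a generator of W. *)
Lemma splitting_no_triple (X Y : 'M[Q k]_2) : right_free 1 U ->
  glbr S X = X *+ 2 -> glbr S Y = - (Y *+ 2) -> glbr X Y = S -> False.
Proof.
move=> [B _ UB] SX SY XY.
have U_B c : U (B *m c) by rewrite UB; exists c.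
have SXv v : S *m (X *m v) = (X *m v) *+ 2 + X *m (S *m v).
  have {1}-> : X *m v *+ 2 = (X *+ 2) *m v by rewrite !mulr2n mulmxDl.
  by rewrite !mulmxA -mulmxDl -SX subrK.
have SYv v : S *m (Y *m v) = - (Y *m v) *+ 2 + Y *m (S *m v).
  have {1}-> : - (Y *m v) *+ 2 = (- (Y *+ 2)) *m v.
    by rewrite !mulr2n mulNmx mulmxDl opprD.
  by rewrite !mulmxA -mulmxDl -SY subrK.
have XW w : kerW k w -> U (X *m w).
  move=> Ww; apply: splitting_fixed.
  by rewrite SXv (S_W Ww) mulmxN mulr2n addrK.
have YU u : U u -> kerW k (Y *m u).
  move=> Uu; apply: splitting_negated.
  by rewrite SYv (S_U Uu) mulr2n subrK.
have YW w : kerW k w -> Y *m w = 0.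
  move=> Ww; have e : S *m (Y *m w) = - (Y *m w) *+ 3.
    by rewrite SYv (S_W Ww) mulmxN -mulrSr.
  (* [S^2 = 1] turns [S (Y w) = - 3 Y w] into [Y w = 9 Y w]. *)
  apply: (@Qmod_mulrn_eq0 _ _ 7); apply: (addrI (Y *m w)); rewrite addr0 -mulrS.
  rewrite -{2}[Y *m w]mul1mx -splitting_involution -mulmxA e.
  move: e; set t := Y *m w => e.
  have -> : - t *+ 3 = - (t + t + t) by rewrite mulNrn !mulrS mulr0n addr0 addrA.
  rewrite mulmxN !mulmxDr e.
  have E (V : zmodType) (x : V) : x *+ 9 = - (- x *+ 3 + - x *+ 3 + - x *+ 3).
    by rewrite !mulNrn -!opprD opprK -!mulrnDr.
  exact: E.
apply: (@kerW_not_cyclic _ (Y *m B) (char0_neq0 1)).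
  by apply: YU; rewrite -[B]mulmx1.
move=> w Ww; have := XW _ Ww; rewrite {1}UB => -[c _ cw]; exists c.
rewrite -mulmxA cw mulmxA; apply/oppr_inj.
by rewrite -(S_W Ww) -XY mulmxBl -(mulmxA X) (YW _ Ww) mulmx0 sub0r.
Qed.
End Splitting.

(** * Involutions as elements of the extended affine Lie algebra *)

Section InvolutionCube.
Variable k : comNzRingType.
Variable S : 'M[Q k]_2.
Hypothesis SS : S *m S = 1%:M.
Implicit Type A : 'M[Q k]_2.

Lemma glbr_anticommute A : S *m glbr S A = - (glbr S A *m S).
Proof.
rewrite /glbr mulmxBr mulmxBl opprB mulmxA SS mul1mx -mulmxA SS mulmx1.
by rewrite mulmxA.
Qed.

(** Differentiate [S^2 = 1]. *)
Lemma Qder_anticommute (th : {additive Z2 -> k}) (dS := map_mx (Qder th) S) :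
  S *m dS = - (dS *m S).
Proof.
have d1 : map_mx (Qder th) (1%:M : 'M[Q k]_2) = 0.
  have := mx_derM th (1%:M : 'M[Q k]_2) 1%:M.
  rewrite !mul1mx mulmx1 => e; apply: (addrI (map_mx (Qder th) 1%:M)).
  by rewrite addr0 -e.
by apply/eqP; rewrite -addr_eq0 addrC -mx_derM SS d1.
Qed.

(** On matrices anticommuting with [S], [ad S] is twice left multiplication by
    the involution [S]. *)
Lemma glbr_glbr A : S *m A = - (A *m S) -> glbr S (glbr S A) = A *+ 4.
Proof.
move=> SA; have AS : A *m S = - (S *m A) by rewrite SA opprK.
have SAE : glbr S A = (S *m A) *+ 2 by rewrite /glbr AS opprK.
have SAS : S *m A *m S = - A by rewrite -mulmxA AS mulmxN mulmxA SS mul1mx.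
have GS : glbr S A *m S = - A - A by rewrite SAE mulr2n mulmxDl SAS.
rewrite {1}/glbr glbr_anticommute GS.
have E (V : zmodType) (x : V) : - (- x - x) - (- x - x) = x *+ 4.
  by rewrite -!opprD opprK -!mulr2n -mulrnA.
exact: E.
Qed.

Lemma anticommuteBZ (c : k) A B : S *m A = - (A *m S) -> S *m B = - (B *m S) ->
  S *m (A - kQ c *: B) = - ((A - kQ c *: B) *m S).
Proof.
move=> SA SB; rewrite mulmxBr mulmxBl (scale_mulmxr c S B) SA SB.
by rewrite -(scalemxAl (kQ c) B S) scalerN -opprD.
Qed.

End InvolutionCube.

Section EALA.
Variables (k : fieldType) (th : {additive Z2 -> k}).
Local Notation E := (EALA k).
Local Notation "[ x , y ]" := (Ebr th x y).
Implicit Types (x y : sl2 k) (c : Csp k) (d : Dsp k) (v w : E).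

Lemma sl2_brZl (a : k) x y : sl2_br (a *: x) y = a *: sl2_br x y.
Proof. by apply: val_inj; rewrite /= scale_glbr. Qed.

Lemma sl2_brZr (a : k) x y : sl2_br x (a *: y) = a *: sl2_br x y.
Proof.
apply: val_inj; rewrite /= /glbr scalerBr.
rewrite (scale_mulmxr a (sl2_val x) (sl2_val y)).
by rewrite -(scalemxAl (kQ a) (sl2_val y) (sl2_val x)).
Qed.

Lemma sl2_br0l x : sl2_br 0 x = 0.
Proof. by rewrite -[0](scale0r x) sl2_brZl !scale0r. Qed.

Lemma dthetaZ (a : k) x : dtheta th (a *: x) = a *: dtheta th x.
Proof.
by apply: val_inj; apply/matrixP => i j; rewrite /= !mxE QderZ.
Qed.

Lemma sigma_dtheta0 x y : dtheta th x = 0 -> sigma th x y = 0.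
Proof.
move=> x0; apply/lfunP => d; rewrite sigmaE zero_lfunE /Dact x0 scaler0.
by rewrite -[0](scale0r y) sl2_formZl mul0r.
Qed.

Lemma dtheta0 : dtheta th 0 = 0.
Proof. by rewrite -[0 in LHS](scale0r 0) dthetaZ scale0r. Qed.

Lemma Ebr_central c v : [(0, c, 0), v] = 0.
Proof.
case: v => [[x c'] d].
rewrite /= sl2_br0l sigma_dtheta0 ?dtheta0 // /Dact dtheta0 scaler0 scale0r.
by rewrite !addr0 subrr.
Qed.

Lemma Ebr_L v w : [v, w].1.1 = sl2_br v.1.1 w.1.1 +
  (v.2 : k) *: dtheta th w.1.1 - (w.2 : k) *: dtheta th v.1.1.
Proof. by case: v w => [[x c] d] [[x' c'] d']. Qed.

Lemma Ebr_D v w : [v, w].2 = 0.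
Proof. by case: v w => [[x c] d] [[x' c'] d']. Qed.

Lemma Ebr_Eof x v :
  [Eof x, v].1.1 = sl2_br x v.1.1 - (v.2 : k) *: dtheta th x.
Proof. by rewrite Ebr_L scale0r addr0. Qed.

Lemma Ebr_Eof2 x v w : [Eof x, [v, w]].1.1 = sl2_br x [v, w].1.1.
Proof. by rewrite Ebr_Eof Ebr_D scale0r subr0. Qed.

Lemma eq_EALA_mod_C v w : v.1.1 = w.1.1 -> v.2 = w.2 ->
  v - w = (0, v.1.2 - w.1.2, 0).
Proof.
case: v w => [[x c] d] [[x' c'] d'] /= -> ->.
by rewrite -[LHS]/(x' - x', c - c', d' - d') !subrr.
Qed.

(** The polynomial [x^3 - 4 x], whose roots are the weights 0, 2 and - 2 of an
    sl2-triple acting on a sum of copies of the trivial and the adjoint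
    representation, evaluated at [ad v]. *)
Definition ad_cube v w : E := [v, [v, [v, w]]] - 4 *: [v, w].

Lemma ad_cube_D v w : (ad_cube v w).2 = 0.
Proof.
have E (A B : E) : A.2 = 0 -> B.2 = 0 -> (A - 4 *: B).2 = 0.
  by case: A B => [? a] [? b] /= -> ->; rewrite scaler0 subr0.
by apply: E; apply: Ebr_D.
Qed.

(** Modulo C, [ad S] maps [E] into matrices anticommuting with [S]: commutators
    with [S] do by [S^2 = 1], and so does [dtheta S].  There [(ad S)^2 = 4]. *)
Lemma ad_cube_involution (x : sl2 k) v : sl2_val x *m sl2_val x = 1%:M ->
  exists c, ad_cube (Eof x) v = (0, c, 0).
Proof.
move=> xx; rewrite /ad_cube; set u := [_, v].
have e3 : [Eof x, [Eof x, u]].2 = 4 *: u.2 by rewrite !Ebr_D scaler0.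
have e1 : [Eof x, [Eof x, u]].1.1 = 4 *: u.1.1.
  rewrite !Ebr_Eof2 Ebr_Eof; apply: val_inj; rewrite /=.
  set A := (X in glbr _ (glbr _ X)).
  have -> : kQ 4 = 4 :> Q k by rewrite kQ_in_alg !rmorph_nat.
  rewrite scaler_nat; apply: glbr_glbr => //.
  apply: anticommuteBZ => //; [exact: glbr_anticommute|exact: Qder_anticommute].
exists ([Eof x, [Eof x, u]].1.2 - 4 *: u.1.2).
exact: eq_EALA_mod_C.
Qed.

End EALA.

(** * Weights of the standard MAD *)

Section Weights.
Variables (k : fieldType) (th : {additive Z2 -> k}).
Implicit Types (i j : 'I_2) (l : Z2) (v w : EALA k).

Lemma glbr_scale_delta (A : 'M[Q k]_2) q (i j r s : 'I_2) :
  glbr A (q *: delta_mx i j) r s =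
  (if s == j then A r i * q else 0) - (if r == i then q * A j s else 0).
Proof.
have E (B C : 'M[Q k]_2) : (B - C) r s = B r s - C r s by rewrite !mxE.
by rewrite -mulmx_scale_delta -scale_delta_mulmx -E.
Qed.

Lemma sl2_br_h_unit i j q : i != j ->
  sl2_br (sl2_h k) (sl2_unit i j q) = ((-1) ^+ i * 2) *: sl2_unit i j q.
Proof.
move=> ij; apply: val_inj.
rewrite -[LHS]/(glbr (sl2_val (sl2_h k)) (sl2_val (sl2_unit i j q))).
rewrite -[RHS]/(kQ ((-1) ^+ i * 2) *: sl2_val (sl2_unit i j q)) sl2_unitE //.
apply/matrixP => r s; rewrite glbr_scale_delta.
rewrite /= !mxE; have kQ2 : kQ ((-1) ^+ i * 2) = (-1) ^+ i *+ 2 :> Q k.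
  by rewrite mulr_natr kQ_in_alg !rmorphMn !rmorphXn !rmorphN1.
rewrite kQ2 (eq_sym j s); have [->|_] := eqVneq r i; last first.
  by rewrite /= mul0r !mulr0 subr0; case: ifP.
have [_|_] := eqVneq s j; last by rewrite /= !mulr0 subr0.
case: (ord2P i) ij => ->; case: (ord2P j) => -> //= _.
  by rewrite expr0 expr1 mul1r mulrN1 opprK mulr1 mulr2n mulrDl mul1r.
by rewrite expr0 expr1 !mulr1 mulN1r mulr2n mulrDl mulN1r.
Qed.

Lemma sl2_br_units i j : i != j ->
  sl2_br (sl2_unit i j 1) (sl2_unit j i 1) = (-1) ^+ i *: sl2_h k.
Proof.
move=> ij; apply: val_inj => /=.
rewrite -[glbr (delta_mx i i) _]/(sl2_val (sl2_unit i j 1)) sl2_unitE //.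
rewrite -[glbr (delta_mx j j) _]/(sl2_val (sl2_unit j i 1)) sl2_unitE 1?eq_sym //.
rewrite !scale1r /glbr !mul_delta_mx; apply/matrixP => r s; rewrite !mxE.
have -> : kQ ((-1) ^+ i) = (-1) ^+ i :> Q k.
  by rewrite kQ_in_alg !rmorphXn !rmorphN1.
case: (ord2P i) ij => ->; case: (ord2P j) => -> //= _;
  case: (ord2P r) => ->; case: (ord2P s) => ->;
  by rewrite /= ?expr0 ?expr1 ?mulr1 ?mulr0 ?mulrN1 ?opprK ?subr0 ?sub0r.
Qed.

Lemma dtheta_unit i j l : i != j ->
  dtheta th (sl2_unit i j (Qmon k l)) = th l *: sl2_unit i j (Qmon k l).
Proof.
move=> ij; apply: dtheta_homog => r s; rewrite sl2_unitE // !mxE.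
exists ((r == i) && (s == j))%:R.
by case: andP => _; rewrite ?kQ1 ?mulr1 ?mul1r // /kQ !scale0r mulr0 mul0r.
Qed.

Lemma sl2_unit_neq0 i j l : i != j -> sl2_unit i j (Qmon k l) != 0.
Proof.
move=> ij; apply/eqP => /(congr1 (@sl2_val k)) /matrixP /(_ i j).
rewrite sl2_unitE // !mxE !eqxx mulr1 => /(congr1 (Qcoef l)) /eqP.
by rewrite Qcoef_mon eqxx Qcoef0 oner_eq0.
Qed.

Lemma dtheta_h : dtheta th (sl2_h k) = 0.
Proof.
rewrite (@dtheta_homog _ _ 0) ?raddf0 ?scale0r // => r s; rewrite !mxE.
exists (if r == s then (-1) ^+ r else 0); rewrite Qmon0 mulr1.
case: (r == s); last by rewrite /kQ !scale0r.
by rewrite kQ_in_alg !rmorphXn !rmorphN1.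
Qed.

Section Weight.
Variables (a : k) (c : Csp k) (d : Dsp k) (l : Z2).
Let v : EALA k := (a *: sl2_h k, c, d).
Let e := sl2_unit 0 1 (Qmon k l).
Let la : k := 2 * a + (d : k) * th l.

Lemma Ebr_weight w mu : w.1.1 = mu *: e -> w.2 = 0 ->
  (Ebr th v w).1.1 = (la * mu) *: e.
Proof.
move=> w1 w2; rewrite Ebr_L w1 w2 scale0r subr0 /= dthetaZ dtheta_unit //.
rewrite sl2_brZl sl2_brZr sl2_br_h_unit // !scalerA -scalerDl.
rewrite expr0 mul1r.
have <- // : la * mu = a * mu * 2 + (d : k) * mu * th l by rewrite /la; ring.
Qed.

Lemma ad_cube_weight :
  (ad_cube th v (Eof e)).1.1 = (la ^+ 3 - 4 * la) *: e.
Proof.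
have E1 : (Ebr th v (Eof e)).1.1 = la *: e.
  by rewrite (@Ebr_weight _ 1) ?mulr1 ?scale1r.
have E2 := Ebr_weight E1 (Ebr_D _ _ _).
have E3 := Ebr_weight E2 (Ebr_D _ _ _).
have E (A B u : sl2 k) : B = la *: u -> A = (la * (la * la)) *: u ->
    A - 4 *: B = (la ^+ 3 - 4 * la) *: u.
  by move=> -> ->; rewrite scalerA -scalerBl; congr (_ *: _); ring.
exact: (E _ _ _ E1 E3).
Qed.

End Weight.

Lemma EALA_centre v : 2 != 0 :> k -> v.2 = 0 ->
  (forall w, Ebr th v w = 0) -> v.1.1 = 0.
Proof.
move=> nz2 v2 vC; apply: sl2_centre => // x.
have := congr1 (fun w => w.1.1) (vC (Eof x)).
by rewrite Ebr_L v2 /= !scale0r addr0 subr0.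
Qed.

End Weights.

Section Automorphism.
Variables (k : fieldType) (th : {additive Z2 -> k}).
Hypotheses (char0 : [pchar k] =i pred0) (th10 : th ((1, 0) : Z2) = 1).
Implicit Types (v w : EALA k).

(** [2 a + d n] is a root of [x^3 - 4 x] for every [n], as seen on [i^n E_12].
    The third difference of these values in [n] is [6 d^3]. *)
Lemma ad_cube_central_h (a : k) (c : Csp k) (d : Dsp k)
    (v := (a *: sl2_h k, c, d) : EALA k) :
  (forall w u, Ebr th (ad_cube th v w) u = 0) ->
  d = 0 /\ (a = 0 \/ exists i : 'I_2, a = (-1) ^+ i).
Proof.
move=> vC; have nz2 := char0_neq0 char0 1.
have root n (la := 2 * a + (d : k) * n%:R) : la ^+ 3 - 4 * la = 0.
  pose l : Z2 := ((1, 0) : Z2) *+ n.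
  have thl : th l = n%:R by rewrite raddfMn th10.
  have := ad_cube_weight th a c d l; rewrite thl.
  rewrite (EALA_centre nz2 _ (vC _)) => [/esym/eqP|].
    by rewrite scaler_eq0 (negbTE (@sl2_unit_neq0 k 0 1 l isT)) orbF => /eqP.
  exact: ad_cube_D.
have d0 : d = 0.
  have : 6 * (d : k) ^+ 3 = 0.
    pose f n : k := (2 * a + (d : k) * n%:R) ^+ 3 - 4 * (2 * a + (d : k) * n%:R).
    have -> : 6 * (d : k) ^+ 3 = f 3%N - 3 * f 2%N + 3 * f 1%N - f 0%N.
      by rewrite /f; ring.
    by rewrite /f !root; ring.
  by move/eqP; rewrite mulf_eq0 (negbTE (char0_neq0 char0 5)) expf_eq0 => /eqP.
split=> //; have := root 0%N; rewrite mulr0 addr0 => /eqP.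
rewrite (_ : _ - _ = 8 * (a * (a - 1) * (a + 1))); last by ring.
rewrite !mulf_eq0 (negbTE (char0_neq0 char0 7)) /= -orbA.
case/or3P => [/eqP|e|e]; first by left.
  by right; exists 0; rewrite expr0; apply/eqP; rewrite -subr_eq0.
by right; exists 1; rewrite expr1; apply/eqP; rewrite -addr_eq0.
Qed.

Lemma Ebr_degree0 (x y : sl2 k) (c : Csp k) : dtheta th x = 0 ->
  Ebr th (x, c, 0) (Eof y) = Eof (sl2_br x y).
Proof.
move=> x0; rewrite /Eof /= sigma_dtheta0 // /Dact x0 scaler0.
by rewrite (scale0r (dtheta th y)) subr0 addr0.
Qed.

Lemma dtheta_unit1 (i j : 'I_2) : i != j -> dtheta th (sl2_unit i j 1) = 0.
Proof. by move=> ij; rewrite -Qmon0 dtheta_unit // raddf0 scale0r. Qed.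

Lemma EofZ (a : k) (x : sl2 k) : Eof (a *: x) = a *: Eof x.
Proof. by rewrite -[RHS]/(a *: x, a *: (0 : Csp k), a *: (0 : Dsp k)) !scaler0. Qed.

(** The element [c] of C only enters the last relation: it is central, and the
    cocycle vanishes on elements killed by [dtheta]. *)
Lemma Ebr_h_triple (i j : 'I_2) (c : Csp k) (v := ((-1) ^+ i *: sl2_h k, c, 0) : EALA k)
    (e := Eof (sl2_unit i j 1)) (f := Eof (sl2_unit j i 1)) : i != j ->
  [/\ Ebr th v e = 2 *: e, Ebr th v f = - 2 *: f & Ebr th e f = v - (0, c, 0)].
Proof.
move=> ij; have ji : j != i by rewrite eq_sym.
have hC x : Ebr th v (Eof x) = (-1) ^+ i *: Eof (sl2_br (sl2_h k) x).
  by rewrite Ebr_degree0 ?dthetaZ ?dtheta_h ?scaler0 // sl2_brZl EofZ.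
have ji1 : (-1) ^+ j = - (-1) ^+ i :> k.
  by case: (ord2P i) (ord2P j) ij => -> [] -> //=; rewrite ?expr0 ?expr1 ?opprK.
split.
- rewrite hC sl2_br_h_unit // EofZ scalerA mulrA -expr2 -exprM mulnC exprM.
  by rewrite sqrrN expr1n expr1n mul1r.
- rewrite hC sl2_br_h_unit // EofZ scalerA ji1 mulrA mulrN -expr2 -exprM mulnC exprM.
  by rewrite sqrrN expr1n expr1n mulN1r.
rewrite /e Ebr_degree0 ?dtheta_unit1 // sl2_br_units //.
by rewrite -[RHS]/(_ - 0, c - c, 0 - 0) !subr0 subrr.
Qed.

End Automorphism.

(** * Non-conjugacy *)

(** The D-components of the preimages of the matrix units vanish because these
    preimages are eigenvectors of [ad S] for nonzero eigenvalues.  What is lost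
    modulo C is recovered from the triviality of the centre of sl2(Q). *)
Lemma standard_pullback_triple (k : fieldType) (th : {additive Z2 -> k})
    (phi : {linear EALA k -> EALA k}) (S : sl2 k) :
  [pchar k] =i pred0 -> th ((1, 0) : Z2) = 1 -> is_lie_aut (Ebr th) phi ->
  sl2_val S *m sl2_val S = 1%:M -> S <> 0 -> stdMAD k (phi (Eof S)) ->
  exists X Y, [/\ sl2_br S X = 2 *: X, sl2_br S Y = - 2 *: Y & sl2_br X Y = S].
Proof.
move=> char0 th10 [phi_bij phiM] SS S0.
have phi_inj := bij_inj phi_bij; have [psi _ psiK] := phi_bij.
have nz2 := char0_neq0 char0 1.
have phiZ (b : k) v : phi (b *: v) = b *: phi v by rewrite linearZ.
have centralP v c : phi v = (0, c, 0) -> forall w, Ebr th v w = 0.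
  by move=> e w; apply: phi_inj; rewrite phiM e Ebr_central raddf0.
case Ev : (phi (Eof S)) => [[x c] d] [a /= xE]; rewrite {x}xE in Ev.
have [|d0 ai] := @ad_cube_central_h _ th char0 th10 a c d.
  move=> w u; rewrite -(psiK u) -(psiK w) -Ev.
  have -> : ad_cube th (phi (Eof S)) (phi (psi w)) = phi (ad_cube th (Eof S) (psi w)).
    by rewrite /ad_cube linearB phiZ !phiM.
  have [c' ->] := ad_cube_involution th (psi w) SS.
  by rewrite -phiM Ebr_central raddf0.
rewrite {d}d0 in Ev; case: ai => [a0|[i ai]].
  rewrite {a}a0 scale0r in Ev; case: S0.
  by apply: (@EALA_centre _ th (Eof S) nz2) => //; exact: centralP Ev.
(* For [a = 1] take the triple on [E_12], for [a = -1] the one on [E_21]. *)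
have [j ij] : exists j : 'I_2, i != j.
  by case: (ord2P i) => ->; [exists 1|exists 0].
have [He Hf Hef] := Ebr_h_triple th c ij; rewrite -ai -Ev in He Hf Hef.
have [e phi_e] : exists e, phi e = Eof (sl2_unit i j 1) by eexists; exact: psiK.
have [f phi_f] : exists f, phi f = Eof (sl2_unit j i 1) by eexists; exact: psiK.
have Se : Ebr th (Eof S) e = 2 *: e.
  apply: phi_inj; rewrite phiM phiZ phi_e.
  exact: He.
have Sf : Ebr th (Eof S) f = - 2 *: f.
  apply: phi_inj; rewrite phiM phiZ phi_f.
  exact: Hf.
have eig_L v (b : k) : b != 0 -> Ebr th (Eof S) v = b *: v ->
    v.2 = 0 /\ sl2_br S v.1.1 = b *: v.1.1.
  move=> b0 Sv; have v2 : v.2 = 0.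
    have := congr1 (fun w : EALA k => w.2) Sv; rewrite Ebr_D.
    by move/esym/eqP; rewrite -[X in X == _]/(b *: v.2) scaler_eq0 (negbTE b0) => /eqP.
  split; first exact: v2.
  have := congr1 (fun w : EALA k => w.1.1) Sv.
  by rewrite Ebr_Eof v2 scale0r subr0.
have [e2 Se1] := eig_L _ _ nz2 Se.
have nzN2 : - 2 != 0 :> k by rewrite oppr_eq0.
have [f2 Sf1] := eig_L _ _ nzN2 Sf.
exists e.1.1, f.1.1; split; [exact: Se1|exact: Sf1|].
have phi_z : phi (Eof S - Ebr th e f) = (0, c, 0).
  rewrite linearB phiM phi_e phi_f Hef.
  by rewrite subKr.
have := EALA_centre nz2 _ (centralP _ _ phi_z).
have -> : (Eof S - Ebr th e f).1.1 = S - (Ebr th e f).1.1 by [].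
rewrite Ebr_L e2 f2 !scale0r addr0 subr0.
move=> H; apply/esym/eqP; rewrite -subr_eq0; apply/eqP/H.
by rewrite -[LHS]/(0 - (Ebr th e f).2) Ebr_D subr0.
Qed.

Theorem theorem2p10 (k : closedFieldType) (char0 : [pchar k] =i pred0)
    (theta : {additive Z2 -> k})
    (theta10 : theta ((1, 0) : Z2) = 1)
    (theta01 : forall r : rat, theta ((0, 1) : Z2) <> ratr r)
    (U : set 'cV[Q k]_2)
    (U_free : right_free 1 U)
    (V_eq : internal_direct_sum (kerW k) U)
    (S : sl2 k)
    (S_W : forall w, kerW k w -> sl2_val S *m w = - w)
    (S_U : forall u, U u -> sl2_val S *m u = u)
    (H' : set (EALA k))
    (H'_MAD : is_MAD (Ebr theta) H')
    (H'_S : H' (Eof S)) :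
  ~ exists phi : {linear EALA k -> EALA k},
      is_lie_aut (Ebr theta) phi /\ phi @` H' = stdMAD k.
Proof.
move=> [phi [phi_aut phiH]].
have SS := splitting_involution V_eq S_W S_U.
have S0 : S <> 0.
  (* If [S = 0] then W, where [S] acts by [- 1], is zero, hence cyclic. *)
  move=> S0; apply: (@kerW_not_cyclic k 0 (char0_neq0 char0 1)).
    by rewrite /mQ !mxE !mulr0 subrr.
  move=> w /S_W; rewrite S0 mul0mx => /esym/eqP; rewrite oppr_eq0 => /eqP ->.
  by exists 0; rewrite mulmx0.
have phiS : stdMAD k (phi (Eof S)) by rewrite -phiH; exists (Eof S).
have [X [Y [SX SY XY]]] := standard_pullback_triple char0 theta10 phi_aut SS S0 phiS.
have kQ2 : kQ 2 = 2 :> Q k by rewrite kQ_in_alg !rmorph_nat.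
apply: (splitting_no_triple char0 V_eq S_W S_U U_free (X := sl2_val X) (Y := sl2_val Y)).
- by rewrite -[LHS]/(sl2_val (sl2_br S X)) SX /= kQ2 scaler_nat.
- rewrite -[LHS]/(sl2_val (sl2_br S Y)) SY /=.
  have -> : kQ (- 2) = - 2 :> Q k by rewrite kQ_in_alg !rmorphN !rmorph_nat.
  by rewrite scaleNr scaler_nat.
- by rewrite -XY.
Qed.
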